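(* Let $\alpha,\beta,\gamma,\delta\in(0,\pi)$ with $\gamma=\pi-\alpha$, $\delta=\pi-\beta$, $\beta\neq\alpha$, $\alpha+\beta\neq\pi$ (an ''anti-isogram''). Then the configuration space of the spherical 4-bar linkage with sector angles $\alpha,\beta,\gamma,\delta$ is the union of the following two branches, each diffeomorphic to a circle $S^1$: the set of all $$(x,y,z,w)=\left(t,\ -\frac{t\sin\frac{\alpha-\beta}{2}}{\sin\frac{\alpha+\beta}{2}},\ t,\ -\frac{t\sin\frac{\beta-\alpha}{2}}{\sin\frac{\beta+\alpha}{2}}\right),\quad t\in\mathbb{R}\cup\{\infty\},$$ and the set of all $$(x,y,z,w)=\left(t,\ -\frac{t\cos\frac{\alpha-\beta}{2}}{\cos\frac{\alpha+\beta}{2}},\ -t,\ -\frac{t\cos\frac{\beta-\alpha}{2}}{\cos\frac{\beta+\alpha}{2}}\right),\quad t\in\mathbb{R}\cup\{\infty\}.$$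
   Context: A configuration of the spherical 4-bar linkage (degree-4 single-vertex rigid origami) with sector angles $\alpha,\beta,\gamma,\delta\in(0,\pi)$ is a quadruple of folding angles $(\rho_x,\rho_y,\rho_z,\rho_w)\in(\mathbb{R}/2\pi\mathbb{Z})^4$ satisfying the closure condition $$R_3(\alpha)R_1(\rho_x)R_3(\beta)R_1(\rho_y)R_3(\gamma)R_1(\rho_z)R_3(\delta)R_1(\rho_w)=I,$$ where $R_1(\theta),R_3(\theta)\in SO(3)$ are the rotations by $\theta$ about the first and third coordinate axes. (Panel $\alpha$ lies between creases $w$ and $x$, $\beta$ between $x$ and $y$, $\gamma$ between $y$ and $z$, $\delta$ between $z$ and $w$.) Configurations are recorded by $x=\tan(\rho_x/2)$, $y=\tan(\rho_y/2)$, $z=\tan(\rho_z/2)$, $w=\tan(\rho_w/2)$ in $\mathbb{R}\cup\{\infty\}$, the one-point compactification (a folding angle $\pi$ corresponds to $\infty$; $-\infty$ and $\infty$ are identified), which is identified as a smooth manifold with the circle $\mathbb{R}/2\pi\mathbb{Z}$. The configuration space is the set of all such $(x,y,z,w)\in(\mathbb{R}\cup\{\infty\})^4$. For $c\neq0$ real, $c\cdot\infty=\infty$. *)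

(* Defs.v *)
From HB Require Import structures.
From mathcomp Require Import all_boot all_order all_algebra.
From mathcomp Require Import all_classical all_reals all_analysis.

Set Implicit Arguments.
Unset Strict Implicit.
Unset Printing Implicit Defensive.

Import Order.TTheory GRing.Theory Num.Theory.
Import numFieldNormedType.Exports.

Local Open Scope classical_set_scope.
Local Open Scope ring_scope.

Section Linkage.
Variable R : realType.

Definition rot1 (t : R) : 'M[R]_3 :=
  \matrix_(i, j) (nth [::]
    [:: [:: 1; 0;     0        ];
        [:: 0; cos t; - (sin t)];
        [:: 0; sin t; cos t    ]] i)`_j.

Definition rot3 (t : R) : 'M[R]_3 :=
  \matrix_(i, j) (nth [::]
    [:: [:: cos t; - (sin t); 0];
        [:: sin t; cos t;     0];
        [:: 0;     0;         1]] i)`_j.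

(* R u {oo}, with oo = None. *)
Definition Rhat : Type := one_point_compactification R.

Definition Rhat4 : Type := (Rhat * Rhat * Rhat * Rhat)%type.

(* tan (rho / 2) in R u {oo}; it is 2 pi-periodic in rho, so a folding angle in
   R / 2 pi Z can be given by any real representative. *)
Definition tan_half (rho : R) : Rhat :=
  if cos (rho / 2) == 0 then None else Some (tan (rho / 2)).

Definition linkage_closure (a b c d rx ry rz rw : R) : Prop :=
  rot3 a *m rot1 rx *m rot3 b *m rot1 ry *m
  rot3 c *m rot1 rz *m rot3 d *m rot1 rw = 1%:M.

Definition config_space (a b c d : R) : set Rhat4 :=
  [set p | exists rx ry rz rw : R,
     linkage_closure a b c d rx ry rz rw /\
     p = (tan_half rx, tan_half ry, tan_half rz, tan_half rw)].

(* c * oo = oo is the intended convention for c != 0 only. *)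
Definition Rhat_scale (c : R) (u : Rhat) : Rhat :=
  if u is Some x then Some (c * x) else None.

Definition branch1 (a b : R) : set Rhat4 :=
  [set (t,
        Rhat_scale (- (sin ((a - b) / 2) / sin ((a + b) / 2))) t,
        t,
        Rhat_scale (- (sin ((b - a) / 2) / sin ((b + a) / 2))) t)
  | t in [set: Rhat]].

Definition branch2 (a b : R) : set Rhat4 :=
  [set (t,
        Rhat_scale (- (cos ((a - b) / 2) / cos ((a + b) / 2))) t,
        Rhat_scale (-1) t,
        Rhat_scale (- (cos ((b - a) / 2) / cos ((b + a) / 2))) t)
  | t in [set: Rhat]].

(* C^k on an open set U: all iterated partial derivatives of order <= k exist
   and are continuous at the points of U. *)
Fixpoint Ck_on (n m k : nat) (U : set 'rV[R]_n) (F : 'rV[R]_n -> 'rV[R]_m)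
    : Prop :=
  (forall x, U x -> {for x, continuous F}) /\
  if k is k'.+1 then
    forall i : 'I_n,
      (forall x, U x -> derivable F x (delta_mx 0 i)) /\
      Ck_on k' U ('D_(delta_mx 0 i) F)
  else True.

(* Smooth map on an arbitrary subset A of R^n: near every point of A it is the
   restriction of a C^oo map defined on an open set of R^n. *)
Definition smooth_on (n m : nat) (A : set 'rV[R]_n)
    (f : 'rV[R]_n -> 'rV[R]_m) : Prop :=
  forall x, A x -> exists (U : set 'rV[R]_n) (F : 'rV[R]_n -> 'rV[R]_m),
    [/\ open U, U x, forall k, Ck_on k U F & forall y, A y -> U y -> F y = f y].

Definition diffeomorphic (n m : nat) (A : set 'rV[R]_n) (B : set 'rV[R]_m)
    : Prop :=
  exists (f : 'rV[R]_n -> 'rV[R]_m) (g : 'rV[R]_m -> 'rV[R]_n),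
    [/\ smooth_on A f, smooth_on B g,
        forall x, A x -> B (f x) /\ g (f x) = x &
        forall y, B y -> A (g y) /\ f (g y) = y].

Definition unit_circle : set 'rV[R]_2 :=
  [set v | v 0 0 ^+ 2 + v 0 1 ^+ 2 = 1].

(* The representative in ]-pi, pi] of the inverse of tan_half. *)
Definition fold_angle (u : Rhat) : R :=
  if u is Some x then 2 * atan x else pi.

Lemma fold_angleK (u : Rhat) : tan_half (fold_angle u) = u.
Proof.
rewrite /tan_half /fold_angle; case: u => [x|]; last by rewrite cos_pihalf eqxx.
have -> : 2 * atan x / 2 = atan x by rewrite mulrAC divff ?mul1r ?pnatr_eq0.
by rewrite gt_eqF ?atanK // cos_gt0_pihalf // atan_gtNpi2 atan_ltpi2.
Qed.

(* The manifold structure of R u {oo} is that of R / 2 pi Z under tan_half, and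
   R / 2 pi Z is the unit circle under rho |-> (cos rho, sin rho). *)
Definition Rhat_embed (u : Rhat) : 'rV[R]_2 :=
  \row_j [:: cos (fold_angle u); sin (fold_angle u)]`_j.

(* (R u {oo})^4 as the product of four unit circles in R^8. *)
Definition Rhat4_embed (p : Rhat4) : 'rV[R]_(2 + 2 + (2 + 2)) :=
  let: (x, y, z, w) := p in
  row_mx (row_mx (Rhat_embed x) (Rhat_embed y))
         (row_mx (Rhat_embed z) (Rhat_embed w)).

Definition diffeomorphic_to_circle (B : set Rhat4) : Prop :=
  diffeomorphic (Rhat4_embed @` B) unit_circle.

End Linkage.

(* Main.v *)
Require Import Defs.
From mathcomp Require Import all_boot all_order all_algebra.
From mathcomp Require Import all_classical all_reals all_analysis.
From mathcomp Require Import ring lra.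
Import Order.TTheory GRing.Theory Num.Theory.
Import numFieldNormedType.Exports.

Set Implicit Arguments.
Unset Strict Implicit.
Unset Printing Implicit Defensive.

Local Open Scope classical_set_scope.
Local Open Scope ring_scope.

(** Cut the linkage into [M = R3(a) R1(x) R3(b)] and
    [N = (R3(c) R1(z) R3(d))^-1]; closure reads [R1(w) M R1(y) = N].
    The rotations [R1(w)], [R1(y)] leave unchanged the corner entry [M 0 0]; for an
    anti-isogram equality of the corner entries says [cos x = cos z], that is,
    [z = x] or [z = -x].  Given such a [z], the first column of the equation is
    a planar rotation by [w] and the first row a planar rotation by [y], so
    [w] and [y] exist, and tangents of half-angles of planar rotations turn
    out to be constant multiples of [tan (x / 2)].  Conversely, the first row
    and the first column determine an element of SO(3) unless the corner entry
    is 1 or -1, so they suffice for closure.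
    Each branch is the graph over the first circle of maps
    [tan (r / 2) |-> k tan (r / 2)], which are restrictions of rational maps
    of the plane without poles. *)

(** * Smoothness of rational functions without poles *)

(** A syntactic class of rational functions: inversion is allowed only for a denominator that
    vanishes nowhere. Closure under directional derivatives makes smoothness of every order an
    induction. *)
Inductive pole_free {R : realType} {n : nat} : ('rV[R]_n -> R) -> Prop :=
| pole_free_cst c : pole_free (fun=> c)
| pole_free_coord j : pole_free (fun v => v 0 j)
| pole_freeD f g : pole_free f -> pole_free g -> pole_free (fun v => f v + g v)
| pole_freeM f g : pole_free f -> pole_free g -> pole_free (fun v => f v * g v)
| pole_freeV f : pole_free f -> (forall v, f v != 0) ->
    pole_free (fun v => (f v)^-1).

Section Smooth.
Context {R : realType}.

Lemma pole_freeB {n} (f g : 'rV[R]_n -> R) :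
  pole_free f -> pole_free g -> pole_free (fun v => f v - g v).
Proof.
move=> pf pg; rewrite (_ : (fun v => _) = fun v => f v + (-1) * g v).
  by apply: pole_freeD pf _; apply: pole_freeM pg; exact: pole_free_cst.
by apply/funext => v; rewrite mulN1r.
Qed.

Lemma pole_freeX {n} (f : 'rV[R]_n -> R) k :
  pole_free f -> pole_free (fun v => f v ^+ k).
Proof.
move=> pf; elim: k => [|k IH]; first exact: pole_free_cst.
rewrite (_ : (fun v => _) = fun v => f v * f v ^+ k); first exact: pole_freeM.
by apply/funext => v; rewrite exprS.
Qed.

Lemma pole_free_differentiable {n} (f : 'rV[R]_n -> R) v :
  pole_free f -> differentiable f v.
Proof.
elim=> {f} [c|j|f g _ df _ dg|f g _ df _ dg|f _ df f0].
- exact: differentiable_cst.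
- exact: differentiable_coord.
- exact: differentiableD.
- exact: differentiableM.
- exact: differentiableV.
Qed.

Lemma pole_free_derivable {n} (f : 'rV[R]_n -> R) v e :
  pole_free f -> derivable f v e.
Proof. by move=> /pole_free_differentiable df; exact: diff_derivable. Qed.

Lemma derive_coord {n} (v e : 'rV[R]_n) j :
  'D_e (fun u : 'rV[R]_n => u 0 j) v = e 0 j.
Proof.
have /derive_mx : derivable (@id 'rV[R]_n) v e by exact: derivable_id.
by rewrite derive_id => /matrixP/(_ 0 j); rewrite mxE.
Qed.

Lemma pole_free_derive {n} (f : 'rV[R]_n -> R) e :
  pole_free f -> pole_free ('D_e f).
Proof.
elim=> {f} [c|j|f g pf df pg dg|f g pf df pg dg|f pf df f0].
- rewrite (_ : 'D_e _ = fun=> 0); first exact: pole_free_cst.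
  by apply/funext => v; rewrite derive_cst.
- rewrite (_ : 'D_e _ = fun=> e 0 j); first exact: pole_free_cst.
  by apply/funext => v; rewrite derive_coord.
- rewrite (_ : 'D_e _ = fun v => 'D_e f v + 'D_e g v); first exact: pole_freeD.
  by apply/funext => v; rewrite [LHS]deriveD //; exact: pole_free_derivable.
- rewrite (_ : 'D_e _ = fun v => f v * 'D_e g v + g v * 'D_e f v).
    by apply: pole_freeD; exact: pole_freeM.
  by apply/funext => v; rewrite [LHS]deriveM //; exact: pole_free_derivable.
- rewrite (_ : 'D_e _ = fun v => -1 * (f v * f v)^-1 * 'D_e f v).
    apply: pole_freeM df; apply: pole_freeM; first exact: pole_free_cst.
    by apply: pole_freeV => [|v]; [exact: pole_freeM | rewrite mulf_neq0].
  apply/funext => v; rewrite deriveV //; last exact: pole_free_derivable.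
  by rewrite mulN1r -expr2.
Qed.

Lemma continuous_at_rV {T : topologicalType} {m} (F : T -> 'rV[R]_m) v :
  (forall j, {for v, continuous (fun u => F u 0 j)}) -> {for v, continuous F}.
Proof.
move=> cF; apply/cvgrPdist_le => /= e e0; near=> u.
rewrite /Num.Def.normr/= mx_normrE (bigmax_le _ (ltW e0))//= => i _.
rewrite !mxE/= !ord1; move: i; near: u; apply: filter_forall => /= i.
exact: (cvgrPdist_le _ _).1 (cF i.2) _ e0.
Unshelve. all: by end_near. Qed.

(** Differentiability gives continuity and partial derivatives at each stage, and the partial
    derivatives stay in the class, so the induction on [k] runs for all maps at once. *)
Lemma Ck_on_pole_free {n m} k (F : 'rV[R]_n -> 'rV[R]_m) :
  (forall j, pole_free (fun v => F v 0 j)) -> Ck_on k setT F.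
Proof.
elim: k F => [|k IH] F pF.
all: have derF v e : derivable F v e
  by apply/derivable_mxP => i j; rewrite ord1; exact: pole_free_derivable.
all: have cF : forall v, [set: 'rV[R]_n] v -> {for v, continuous F}.
1,3: by move=> v _; apply: continuous_at_rV => j;
  exact/differentiable_continuous/pole_free_differentiable.
  by split.
split=> // i; split=> // ; apply: IH => j.
rewrite (_ : (fun v => _) = 'D_(delta_mx 0 i) (fun v => F v 0 j)).
  exact: pole_free_derive.
by apply/funext => v; rewrite derive_mx // mxE.
Qed.

Lemma smooth_on_pole_free {n m} (A : set 'rV[R]_n) (F : 'rV[R]_n -> 'rV[R]_m) :
  (forall j, pole_free (fun v => F v 0 j)) -> smooth_on A F.
Proof.
move=> pF v _; exists setT, F; split=> // [|k]; first exact: openT.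
exact: Ck_on_pole_free.
Qed.
End Smooth.

(** * Elements of SO(3) and their minors *)

Section Rotations.
Context {R : realType}.
Implicit Types M N : 'M[R]_3.

Definition so3 M := M *m M^T = 1%:M /\ \det M = 1.

Lemma so3M M N : so3 M -> so3 N -> so3 (M *m N).
Proof.
move=> [MT dM] [NT dN]; split; last by rewrite det_mulmx dM dN mulr1.
by rewrite trmx_mul mulmxA -(mulmxA M) NT mulmx1.
Qed.

(** For determinant 1, transpose and adjugate are both the inverse; hence each entry equals its own
    cofactor. *)
Lemma so3_adj M : so3 M -> M = (\adj M)^T.
Proof.
move=> [MT dM]; apply: trmx_inj; rewrite trmxK.
have := mul_adj_mx M; rewrite dM => aM.
by rewrite -[LHS]mul1mx -aM -mulmxA MT mulmx1.
Qed.

Lemma ord3_case (i : 'I_3) : [\/ i = 0, i = 1 | i = 2%:R].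
Proof.
case: i => [[|[|[|]]]] //= lt_i3;
  [constructor 1|constructor 2|constructor 3]; exact: val_inj.
Qed.

Lemma lift3E :
  (lift (0 : 'I_3) (0 : 'I_2) = 1) * (lift (0 : 'I_3) (1 : 'I_2) = 2%:R) *
  (lift (1 : 'I_3) (0 : 'I_2) = 0) * (lift (1 : 'I_3) (1 : 'I_2) = 2%:R) *
  (lift (2%:R : 'I_3) (0 : 'I_2) = 0) * (lift (2%:R : 'I_3) (1 : 'I_2) = 1).
Proof. by do !split; exact: val_inj. Qed.

Lemma det_mx22 (A : 'M[R]_2) : \det A = A 0 0 * A 1 1 - A 0 1 * A 1 0.
Proof.
rewrite (expand_det_row _ 0) !big_ord_recl big_ord0 /cofactor !det_mx11 !mxE.
have -> : lift ord0 ord0 = 1 :> 'I_2 by exact: val_inj.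
have -> : lift (1 : 'I_2) ord0 = 0 by exact: val_inj.
by rewrite -!(signr_odd _ (_ + _)%N) /=; ring.
Qed.

Lemma cofactor_mx33 M i j : cofactor M i j = (-1) ^+ odd (i + j) *
  (M (lift i 0) (lift j 0) * M (lift i 1) (lift j 1)
   - M (lift i 0) (lift j 1) * M (lift i 1) (lift j 0)).
Proof. by rewrite /cofactor det_mx22 !mxE signr_odd. Qed.

Lemma det_mx33 M : \det M =
  M 0 0 * (M 1 1 * M 2%:R 2%:R - M 1 2%:R * M 2%:R 1)
  - M 0 1 * (M 1 0 * M 2%:R 2%:R - M 1 2%:R * M 2%:R 0)
  + M 0 2%:R * (M 1 0 * M 2%:R 1 - M 1 1 * M 2%:R 0).
Proof.
rewrite (expand_det_row _ 0) !big_ord_recl big_ord0.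
have -> : lift ord0 ord0 = 1 :> 'I_3 by exact: val_inj.
have -> : lift ord0 (lift ord0 ord0) = 2%:R :> 'I_3 by exact: val_inj.
by rewrite !cofactor_mx33 !lift3E /=; ring.
Qed.

Lemma so3_minors M : so3 M ->
  [/\ M 1 1 = M 0 0 * M 2%:R 2%:R - M 0 2%:R * M 2%:R 0,
      M 1 2%:R = M 0 1 * M 2%:R 0 - M 0 0 * M 2%:R 1,
      M 2%:R 1 = M 1 0 * M 0 2%:R - M 0 0 * M 1 2%:R &
      M 2%:R 2%:R = M 0 0 * M 1 1 - M 0 1 * M 1 0].
Proof.
move=> /so3_adj E.
by split; rewrite {1}E !mxE cofactor_mx33 !lift3E /=; ring.
Qed.

(** The cofactor identities tie the four remaining entries in two pairs, (1,1) with (2,2) and (1,2)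
    with (2,1). Each pair solves a linear system of determinant [1 - M 0 0 ^+ 2], with data from the
    first row and column. *)
Lemma so3_row_col_inj M N : so3 M -> so3 N ->
  (forall j, M 0 j = N 0 j) -> (forall i, M i 0 = N i 0) ->
  M 0 0 ^+ 2 != 1 -> M = N.
Proof.
move=> sM sN row col n1.
have [M11 M12 M21 M22] := so3_minors sM.
have [N11 N12 N21 N22] := so3_minors sN.
rewrite -!row -!col in N11 N12 N21 N22.
have n0 : 1 - M 0 0 ^+ 2 != 0 by rewrite subr_eq0 eq_sym.
apply/matrixP => i j.
have [->|->|->] := ord3_case i; have [->|->|->] := ord3_case j;
  rewrite ?row ?col //; apply: (mulfI n0).
(* Substituting the partner entry leaves only entries of the first row and column, common to [M] and
   [N]. *)
- have -> : (1 - M 0 0 ^+ 2) * M 1 1 = - (M 0 0 * (M 0 1 * M 1 0) + M 0 2%:R * M 2%:R 0).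
    by rewrite mulrBl mul1r {1}M11 M22; ring.
  by rewrite mulrBl mul1r {1}N11 N22; ring.
- have -> : (1 - M 0 0 ^+ 2) * M 1 2%:R = M 0 1 * M 2%:R 0 - M 0 0 * (M 1 0 * M 0 2%:R).
    by rewrite mulrBl mul1r {1}M12 M21; ring.
  by rewrite mulrBl mul1r {1}N12 N21; ring.
- have -> : (1 - M 0 0 ^+ 2) * M 2%:R 1 = M 1 0 * M 0 2%:R - M 0 0 * (M 0 1 * M 2%:R 0).
    by rewrite mulrBl mul1r {1}M21 M12; ring.
  by rewrite mulrBl mul1r {1}N21 N12; ring.
- have -> : (1 - M 0 0 ^+ 2) * M 2%:R 2%:R = - (M 0 0 * (M 0 2%:R * M 2%:R 0) + M 0 1 * M 1 0).
    by rewrite mulrBl mul1r {1}M22 M11; ring.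
  by rewrite mulrBl mul1r {1}N22 N11; ring.
Qed.
End Rotations.

(** * Half-angle tangents and planar rotations *)

Section HalfAngle.
Context {R : realType}.

Lemma cos_half (x : R) : cos x = cos (x / 2) ^+ 2 - sin (x / 2) ^+ 2.
Proof. by rewrite {1}(splitr x) cosD !expr2. Qed.

Lemma sin_half (x : R) : sin x = 2 * cos (x / 2) * sin (x / 2).
Proof. by rewrite {1}(splitr x) sinD; ring. Qed.

Lemma cos_sin_neq0 (x : R) : cos x = 0 -> sin x != 0.
Proof.
move=> cx; apply/eqP => sx; have := cos2Dsin2 x.
by rewrite cx sx expr0n addr0 => /eqP; rewrite eq_sym oner_eq0.
Qed.

(** The hypothesis is [tan (w / 2) = k * tan (x / 2)] with denominators cleared. It also covers
    infinity: since [k != 0] and sine and cosine have no common zero, one half-angle cosine vanishes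
    only with the other. *)
Lemma tan_half_scale (k x w : R) : k != 0 ->
  k * cos (w / 2) * sin (x / 2) = sin (w / 2) * cos (x / 2) ->
  tan_half w = Rhat_scale k (tan_half x).
Proof.
move=> k0 E; rewrite /tan_half /Rhat_scale.
have [X0|X0] := eqVneq (cos (x / 2)) 0.
  case: eqVneq => // W0; move: E; rewrite X0 mulr0 => /eqP.
  by rewrite !mulf_eq0 (negPf k0) (negPf W0) (negPf (cos_sin_neq0 X0)).
case: eqVneq => [W0|W0].
  move: E; rewrite W0 mulr0 mul0r => /esym/eqP.
  by rewrite mulf_eq0 (negPf X0) (negPf (cos_sin_neq0 W0)).
congr Some; rewrite /tan; apply: (mulIf X0); apply: (mulfI W0).
transitivity (sin (w / 2) * cos (x / 2)); first by field.
by rewrite -E; field.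
Qed.

Lemma tan_half_sign (e x z : R) : e ^+ 2 = 1 ->
  cos z = cos x -> sin z = e * sin x ->
  tan_half z = Rhat_scale e (tan_half x).
Proof.
move=> e2 cz sz; apply: tan_half_scale.
  by apply/eqP => e0; move: e2; rewrite e0 expr0n => /eqP; rewrite eq_sym oner_eq0.
have Z := cos2Dsin2 (z / 2); have X := cos2Dsin2 (x / 2).
move: cz sz; rewrite (cos_half z) (cos_half x) (sin_half z) (sin_half x) => cz sz.
have Zc : cos (z / 2) ^+ 2 = cos (x / 2) ^+ 2 by lra.
have Zs : sin (z / 2) ^+ 2 = sin (x / 2) ^+ 2 by lra.
have Zp : cos (z / 2) * sin (z / 2) = e * (cos (x / 2) * sin (x / 2)).
  by apply: (@mulfI _ 2); [rewrite pnatr_eq0|rewrite [LHS]mulrA sz; ring].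
(* The angles fix the half-angle sine and cosine only up to a common sign, so the difference is
   squared: its square involves only their squares and products. *)
apply/eqP; rewrite -subr_eq0 -sqrf_eq0; apply/eqP.
transitivity (e ^+ 2 * cos (z / 2) ^+ 2 * sin (x / 2) ^+ 2
  - 2 * e * (cos (z / 2) * sin (z / 2)) * cos (x / 2) * sin (x / 2)
  + sin (z / 2) ^+ 2 * cos (x / 2) ^+ 2); first by ring.
by rewrite Zp Zs Zc; ring: e2.
Qed.

(* If the rotation by [w] maps [P] to [P'], then [tan (w / 2)] is the ratio of
   [P' - P], turned by a right angle, to [P + P']. *)
Lemma tan_half_rotation (n n' k p q p' q' x w : R) :
  cos w * p - sin w * q = p' -> sin w * p + cos w * q = q' ->
  p + p' = n * (1 + cos x) -> q' - q = k * n * sin x ->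
  p - p' = k * n' * (1 - cos x) -> q + q' = n' * sin x ->
  n != 0 -> n' != 0 -> k != 0 ->
  tan_half w = Rhat_scale k (tan_half x).
Proof.
move=> Ep Eq E1 E2 E3 E4 n0 n'0 k0; apply: tan_half_scale => //.
have W := sin2cos2 (w / 2); have X := cos2Dsin2 (x / 2).
(* Two forms of the same half-angle relation: [F1] degenerates where [cos (x / 2) = 0] and [F2]
   where [sin (x / 2) = 0], so both are kept. *)
have F1 : cos (w / 2) * (q' - q) = sin (w / 2) * (p + p').
  by rewrite -Ep -Eq (cos_half w) (sin_half w); ring: W.
have F2 : cos (w / 2) * (p - p') = sin (w / 2) * (q + q').
  by rewrite -Ep -Eq (cos_half w) (sin_half w); ring: W.
move: F1 F2; rewrite E1 E2 E3 E4 (cos_half x) (sin_half x).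
set c := cos (w / 2); set s := sin (w / 2).
set C := cos (x / 2) in X *; set S := sin (x / 2) in X * => F1 F2.
have G1 : C * (k * c * S - s * C) = 0.
  apply: (mulfI n0); rewrite mulr0.
  have S2 : S ^+ 2 = 1 - C ^+ 2 by lra.
  by move: F1; rewrite S2 => F1; lra.
have G2 : S * (k * c * S - s * C) = 0.
  apply: (mulfI n'0); rewrite mulr0.
  have C2 : C ^+ 2 = 1 - S ^+ 2 by lra.
  by move: F2; rewrite C2 => F2; lra.
(* [C] and [S] both annihilate the difference, and [C ^+ 2 + S ^+ 2 = 1]. *)
apply/eqP; rewrite -subr_eq0; apply/eqP.
by rewrite -[LHS]mul1r -X mulrDl !expr2 -(mulrA C) -(mulrA S) G1 G2 !mulr0 addr0.
Qed.

Lemma cos_fold_angle (t : R) : cos (fold_angle (Some t)) = (1 - t ^+ 2) / (1 + t ^+ 2).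
Proof.
have t0 : 0 < 1 + t ^+ 2 by rewrite ltr_pwDl // sqr_ge0.
rewrite /fold_angle mulr_natl cos_mulr2n cos_atan exprVn sqr_sqrtr ?ltW //.
by field; rewrite gt_eqF.
Qed.

Lemma sin_fold_angle (t : R) : sin (fold_angle (Some t)) = 2 * t / (1 + t ^+ 2).
Proof.
have t0 : 0 < 1 + t ^+ 2 by rewrite ltr_pwDl // sqr_ge0.
rewrite /fold_angle mulr_natl sin_mulr2n.
have c0 : cos (atan t) != 0 by rewrite cos_atan invr_eq0 gt_eqF // sqrtr_gt0.
have -> : sin (atan t) = t * cos (atan t) by rewrite -{2}(atanK t) /tan divfK.
have -> : cos (atan t) * (t * cos (atan t)) = t * cos (atan t) ^+ 2 by ring.
rewrite cos_atan exprVn sqr_sqrtr ?ltW //.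
by field; rewrite gt_eqF.
Qed.

Lemma fold_angle_surj (c s : R) : c ^+ 2 + s ^+ 2 = 1 ->
  exists u : Rhat R, cos (fold_angle u) = c /\ sin (fold_angle u) = s.
Proof.
move=> cs; have [c1|c1] := eqVneq (1 + c) 0.
  exists None; rewrite /= cospi sinpi.
  have -> : c = -1 by lra.
  split=> //; apply/esym/eqP; rewrite -sqrf_eq0; apply/eqP.
  by have : c = -1 by [lra]; move=> E; rewrite E in cs; lra.
(* The tangent of half the angle of [(c, s)] is [s / (1 + c)]; the excluded point [(-1, 0)] is
   infinity. *)
exists (Some (s / (1 + c))); rewrite cos_fold_angle sin_fold_angle expr_div_n.
have -> : s ^+ 2 = (1 + c) * (1 - c).
  by rewrite -(addKr (c ^+ 2) (s ^+ 2)) cs; ring.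
have -> : (1 + c) * (1 - c) / (1 + c) ^+ 2 = (1 - c) / (1 + c) by field.
by split; field; rewrite c1 /=; apply/eqP; lra.
Qed.

(** The cosine and sine of [w] are the inner product and the determinant of the two vectors over
    their common squared norm; Lagrange's identity puts them on the unit circle. *)
Lemma rotation_surj (p q p' q' : R) :
  p ^+ 2 + q ^+ 2 != 0 -> p' ^+ 2 + q' ^+ 2 = p ^+ 2 + q ^+ 2 ->
  exists w, cos w * p - sin w * q = p' /\ sin w * p + cos w * q = q'.
Proof.
move=> n0 E; set n := p ^+ 2 + q ^+ 2 in n0 E.
have [|u [cu su]] := @fold_angle_surj ((p * p' + q * q') / n) ((p * q' - q * p') / n).
  rewrite !expr_div_n -mulrDl.
  have -> : (p * p' + q * q') ^+ 2 + (p * q' - q * p') ^+ 2 = n * (p' ^+ 2 + q' ^+ 2).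
    by rewrite /n; ring.
  by rewrite E -expr2 divff // expf_neq0.
exists (fold_angle u); rewrite cu su.
by split; apply: (mulfI n0); rewrite /n; field.
Qed.

End HalfAngle.

(** * Coordinate rotations, and closure as a double coset equation *)

Section RotationMatrices.
Context {R : realType}.
Implicit Types M N : 'M[R]_3.

Lemma so3_rot1 (t : R) : so3 (rot1 t).
Proof.
have E := sin2cos2 t.
split; last first.
  by rewrite det_mx33 !mxE /=; ring: E.
apply/matrixP => i j; rewrite !mxE !big_ord_recl big_ord0 !mxE /=.
by have [->|->|->] := ord3_case i; have [->|->|->] := ord3_case j; rewrite /=; ring: E.
Qed.

Lemma so3_rot3 (t : R) : so3 (rot3 t).
Proof.
have E := sin2cos2 t.
split; last first.
  by rewrite det_mx33 !mxE /=; ring: E.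
apply/matrixP => i j; rewrite !mxE !big_ord_recl big_ord0 !mxE /=.
by have [->|->|->] := ord3_case i; have [->|->|->] := ord3_case j; rewrite /=; ring: E.
Qed.

End RotationMatrices.

Section LinkageClosure.
Context {R : realType}.
Implicit Types M N : 'M[R]_3.

Lemma mulmx3E M N i j :
  (M *m N) i j = M i 0 * N 0 j + M i 1 * N 1 j + M i 2%:R * N 2%:R j.
Proof.
rewrite mxE !big_ord_recl big_ord0 addr0 addrA.
have -> : lift ord0 ord0 = 1 :> 'I_3 by exact: val_inj.
by have -> : lift ord0 (lift ord0 ord0) = 2%:R :> 'I_3 by exact: val_inj.
Qed.

Lemma trmx_entry M i j : M^T i j = M j i.
Proof. by rewrite mxE. Qed.

Lemma so3T M : so3 M -> so3 M^T.
Proof. by move=> [MT dM]; split; [rewrite trmxK mulmx1C | rewrite det_tr]. Qed.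

Lemma so3_row_norm M : so3 M -> M 0 1 ^+ 2 + M 0 2%:R ^+ 2 = 1 - M 0 0 ^+ 2.
Proof.
by move=> [/matrixP/(_ 0 0)]; rewrite mulmx3E !mxE -!expr2 eqxx mulr1n => <- _; ring.
Qed.

Lemma so3_col_norm M : so3 M -> M 1 0 ^+ 2 + M 2%:R 0 ^+ 2 = 1 - M 0 0 ^+ 2.
Proof. by move=> /so3T/so3_row_norm; rewrite !mxE. Qed.

(** The left factor fixes the first row and the right factor the first column. So the corner is
    invariant, the row sees only [y], and the column sees only [w]. *)
Lemma rot1_mul_rot1 M y w : let L := rot1 w *m M *m rot1 y in
  [/\ L 0 0 = M 0 0,
      L 0 1 = M 0 1 * cos y + M 0 2%:R * sin y,
      L 0 2%:R = M 0 2%:R * cos y - M 0 1 * sin y,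
      L 1 0 = cos w * M 1 0 - sin w * M 2%:R 0 &
      L 2%:R 0 = sin w * M 1 0 + cos w * M 2%:R 0].
Proof. by split; rewrite !mulmx3E !mxE /=; ring. Qed.

(** Equal corners give first rows, and first columns, of equal norm off the corner. Independent
    planar rotations then match the columns by [w] and the rows by [y]. *)
Lemma so3_double_coset M N : so3 M -> so3 N ->
  M 0 0 = N 0 0 -> M 0 0 ^+ 2 != 1 ->
  exists y w, rot1 w *m M *m rot1 y = N.
Proof.
move=> sM sN E n1.
have n0 : 1 - M 0 0 ^+ 2 != 0 by rewrite subr_eq0 eq_sym.
have [||w [w1 w2]] := @rotation_surj R (M 1 0) (M 2%:R 0) (N 1 0) (N 2%:R 0).
- by rewrite so3_col_norm.
- by rewrite !so3_col_norm // E.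
(* Right multiplication turns [(M 0 1, M 0 2)] by [- y]; swapping the coordinates reverses the
   sense. *)
have [||y [y1 y2]] := @rotation_surj R (M 0 2%:R) (M 0 1) (N 0 2%:R) (N 0 1).
- by rewrite addrC so3_row_norm.
- by rewrite !(addrC (_ 0 2%:R ^+ 2)) !so3_row_norm // E.
exists y, w; have [L00 L01 L02 L10 L20] := rot1_mul_rot1 M y w.
apply: so3_row_col_inj => //.
- by apply: so3M (so3_rot1 _); apply: so3M sM; exact: so3_rot1.
- move=> j; have [->|->|->] := ord3_case j.
  + by rewrite L00.
  + by rewrite L01 -y2; ring.
  + by rewrite L02 -y1; ring.
- move=> i; have [->|->|->] := ord3_case i.
  + by rewrite L00.
  + by rewrite L10.
  + by rewrite L20.
- by rewrite L00.
Qed.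

Lemma rot3_rot1_rot3 (a x b : R) : let M := rot3 a *m rot1 x *m rot3 b in
  [/\ M 0 0 = cos a * cos b - sin a * sin b * cos x,
      M 0 1 = - (cos a * sin b) - sin a * cos b * cos x,
      M 0 2%:R = sin a * sin x,
      M 1 0 = sin a * cos b + cos a * sin b * cos x &
      M 2%:R 0 = sin b * sin x].
Proof. by split; rewrite !mulmx3E !mxE /=; ring. Qed.

Lemma so3_rot3_rot1_rot3 (a x b : R) : so3 (rot3 a *m rot1 x *m rot3 b).
Proof.
by apply: so3M (so3_rot3 _); apply: so3M (so3_rot1 _); exact: so3_rot3.
Qed.

(** A product equal to the identity may be permuted cyclically, and the inverse of a rotation is its
    transpose. *)
Lemma linkage_closureP (a b c d x y z w : R) :
  linkage_closure a b c d x y z w <->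
  rot1 w *m (rot3 a *m rot1 x *m rot3 b) *m rot1 y
    = (rot3 c *m rot1 z *m rot3 d)^T.
Proof.
rewrite /linkage_closure.
have [MT _] := so3_rot3_rot1_rot3 c z d.
set A := rot3 a *m _ *m _; set B := rot3 c *m _ *m _ in MT *.
have -> : A *m rot1 y *m rot3 c *m rot1 z *m rot3 d *m rot1 w
    = A *m rot1 y *m B *m rot1 w by rewrite /B !mulmxA.
move: A B MT => A B MT.
split=> [/mulmx1C|E].
  rewrite !mulmxA => AB.
  by rewrite -[LHS]mulmx1 -MT mulmxA AB mul1mx.
by apply: mulmx1C; rewrite !mulmxA E; exact: mulmx1C.
Qed.

End LinkageClosure.

(** * The configurations of an anti-isogram *)

Section AntiIsogram.
Context {R : realType}.
Implicit Types a b e k x y z w : R.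

(** Both branches at once: [e] is 1 or -1 according to [z = x] or [z = - x] modulo a full turn, and
    [k] is the ratio of half-angle tangents of [w] and [x]. The two conditions on [k] are compatible
    since [sin a ^+ 2 - sin b ^+ 2 = sin (a + b) * sin (a - b)]. *)
Lemma anti_isogram_fold e k a b x y z w :
  e ^+ 2 = 1 -> cos z = cos x -> sin z = e * sin x ->
  k * sin (a + b) = e * sin a - sin b -> k * (e * sin a + sin b) = sin (a - b) ->
  k != 0 -> sin (a + b) != 0 -> e * sin a + sin b != 0 ->
  linkage_closure a b (pi - a) (pi - b) x y z w ->
  tan_half y = Rhat_scale (- (e * k)) (tan_half x) /\
  tan_half w = Rhat_scale k (tan_half x).
Proof.
move=> e2 cz sz k1 k2 k0 n0 n'0 /linkage_closureP E.
have e0 : e != 0 by rewrite -sqrf_eq0 e2 oner_eq0.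
have [_ M01 M02 M10 M20] := rot3_rot1_rot3 a x b.
have [_ N01 N02 N10 N20] := rot3_rot1_rot3 (pi - a) z (pi - b).
have [_] := rot1_mul_rot1 (rot3 a *m rot1 x *m rot3 b) y w.
rewrite E M01 M02 M10 M20 !trmx_entry N01 N02 N10 N20.
rewrite !sinB !cosB sinpi cospi cz sz => E01 E02 E10 E20.
rewrite !sinB sinD in k1 k2 n0.
split.
(* The vector turned by [y] is the first row off the corner with its last coordinate negated, which
   reverses the sense of right multiplication. *)
- apply: (@tan_half_rotation R (- (sin a * cos b + cos a * sin b))
    (- (sin a + e * sin b))
    _ (- (cos a * sin b) - sin a * cos b * cos x) (- (sin a * sin x))
    (- (sin a * cos b) - cos a * sin b * cos x) (- (e * sin b * sin x))).
  + by apply: etrans; [|apply: etrans; [exact: (esym E01)|]]; ring.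
  + by apply/oppr_inj; apply: etrans; [|apply: etrans; [exact: (esym E02)|]]; ring.
  + by ring.
  + transitivity (e * (k * (sin a * cos b + cos a * sin b)) * sin x); last by ring.
    by rewrite k1; ring: e2.
  + transitivity (k * (e * sin a + sin b) * (1 - cos x)); last by ring: e2.
    by rewrite k2; ring.
  + by ring.
  + by rewrite oppr_eq0.
  + rewrite oppr_eq0; apply: contra n'0 => /eqP n'0.
    apply/eqP; transitivity (e * (sin a + e * sin b)); first by ring: e2.
    by rewrite n'0 mulr0.
  + by rewrite oppr_eq0 mulf_neq0.
- apply: (@tan_half_rotation R (sin a * cos b + cos a * sin b) (e * sin a + sin b)
    _ (sin a * cos b + cos a * sin b * cos x) (sin b * sin x)
    (sin b * cos a + cos b * sin a * cos x) (e * sin a * sin x)) => //.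
  + by rewrite -E10; ring.
  + by rewrite -E20; ring.
  + by ring.
  + by rewrite k1; ring.
  + by rewrite k2; ring.
  + by ring.
Qed.

(** With sectors [u + v] and [u - v], the corner differs from 1 and from -1 by combinations of
    squared sines, respectively cosines, of [u] and [v] with weights [1 + cos x] and [1 - cos x]. *)
Lemma anti_isogram_closed u v x z : cos z = cos x ->
  sin u != 0 -> cos u != 0 -> sin v != 0 -> cos v != 0 ->
  exists y w, linkage_closure (u + v) (u - v) (pi - (u + v)) (pi - (u - v)) x y z w.
Proof.
move=> cz su cu sv cv; set a := u + v; set b := u - v.
have [M00 _ _ _ _] := rot3_rot1_rot3 a x b.
have [N00 _ _ _ _] := rot3_rot1_rot3 (pi - a) z (pi - b).
have [||||y [w E]] := @so3_double_coset R (rot3 a *m rot1 x *m rot3 b)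
  (rot3 (pi - a) *m rot1 z *m rot3 (pi - b))^T.
- exact: so3_rot3_rot1_rot3.
- by apply: so3T; exact: so3_rot3_rot1_rot3.
- by rewrite M00 trmx_entry N00 !sinB !cosB sinpi cospi cz; ring.
- rewrite M00 -subr_eq0 subr_sqr_1.
  have x1 : 0 <= 1 + cos x by have := cos_geN1 x; lra.
  have x2 : 0 <= 1 - cos x by have := cos_le1 x; lra.
  (* The weights are nonnegative with sum 2, so they do not both vanish. *)
  have pos p q : p != 0 -> q != 0 -> 0 < (1 + cos x) * p ^+ 2 + (1 - cos x) * q ^+ 2.
    move=> p0 q0; rewrite lt_def; apply/andP; split; last first.
      by rewrite addr_ge0 // mulr_ge0 // sqr_ge0.
    have p2 : 0 <= (1 + cos x) * p ^+ 2 by rewrite mulr_ge0 ?sqr_ge0.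
    have q2 : 0 <= (1 - cos x) * q ^+ 2 by rewrite mulr_ge0 ?sqr_ge0.
    apply/negP; rewrite (paddr_eq0 p2 q2) (mulf_eq0 _ (p ^+ 2)) (mulf_eq0 _ (q ^+ 2)) 2!sqrf_eq0.
    rewrite (negPf p0) (negPf q0) !orbF => /andP[/eqP ? /eqP ?].
    by lra.
  have Su := sin2cos2 u; have Sv := sin2cos2 v.
  have -> : cos a * cos b - sin a * sin b * cos x - 1
      = - ((1 + cos x) * sin u ^+ 2 + (1 - cos x) * sin v ^+ 2).
    by rewrite /a /b !(sinB, sinD, cosB, cosD); ring: Su Sv.
  have -> : cos a * cos b - sin a * sin b * cos x + 1
      = (1 + cos x) * cos u ^+ 2 + (1 - cos x) * cos v ^+ 2.
    by rewrite /a /b !(sinB, sinD, cosB, cosD); ring: Su Sv.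
  by rewrite mulf_neq0 ?oppr_eq0 // gt_eqF // pos.
by exists y, w; apply/linkage_closureP.
Qed.

Lemma config_space_anti_isogram u v : sin (u + v) != 0 -> sin (u - v) != 0 ->
  sin u != 0 -> cos u != 0 -> sin v != 0 -> cos v != 0 ->
  config_space (u + v) (u - v) (pi - (u + v)) (pi - (u - v)) =
  [set (t, Rhat_scale (- (sin v / sin u)) t, t, Rhat_scale (sin v / sin u) t)
     | t in [set: Rhat R]] `|`
  [set (t, Rhat_scale (- (cos v / cos u)) t, Rhat_scale (-1) t,
        Rhat_scale (- (cos v / cos u)) t) | t in [set: Rhat R]].
Proof.
move=> sa sb su cu sv cv.
have two : 2 != 0 :> R by rewrite pnatr_eq0.
have sD : sin (u + v + (u - v)) = 2 * sin u * cos u.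
  by rewrite (_ : _ + _ = u + u) ?sinD; ring.
have sB : sin (u + v - (u - v)) = 2 * sin v * cos v.
  by rewrite (_ : _ - _ = v + v) ?sinD; ring.
have sD0 : sin (u + v + (u - v)) != 0 by rewrite sD !mulf_neq0.
(* Sum-to-product formulas turn the conditions on the ratio into [k = sin v / sin u] for [e = 1],
   and into [k = - (cos v / cos u)] for [e = -1] below. *)
have plus x y z w : cos z = cos x -> sin z = sin x ->
  linkage_closure (u + v) (u - v) (pi - (u + v)) (pi - (u - v)) x y z w ->
  [/\ tan_half y = Rhat_scale (- (sin v / sin u)) (tan_half x),
      tan_half z = tan_half x &
      tan_half w = Rhat_scale (sin v / sin u) (tan_half x)].
  move=> cz sz C.
  have [||||||||ty tw] := @anti_isogram_fold 1 (sin v / sin u) _ _ x y z w _ _ _ _ _ _ _ _ C.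
  - by rewrite expr1n.
  - by [].
  - by rewrite mul1r.
  - by rewrite sD sinD sinB; field.
  - by rewrite sB sinD sinB; field.
  - by rewrite mulf_neq0 ?invr_eq0.
  - by [].
  - have -> : 1 * sin (u + v) + sin (u - v) = 2 * sin u * cos v.
      by rewrite sinD sinB; ring.
    by rewrite !mulf_neq0.
  split=> //; first by rewrite ty mul1r.
  rewrite (@tan_half_sign _ 1 x z) ?expr1n ?mul1r //.
  by rewrite /Rhat_scale; case: tan_half => // t; rewrite mul1r.
have minus x y z w : cos z = cos x -> sin z = - sin x ->
  linkage_closure (u + v) (u - v) (pi - (u + v)) (pi - (u - v)) x y z w ->
  [/\ tan_half y = Rhat_scale (- (cos v / cos u)) (tan_half x),
      tan_half z = Rhat_scale (-1) (tan_half x) &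
      tan_half w = Rhat_scale (- (cos v / cos u)) (tan_half x)].
  move=> cz sz C.
  have [||||||||ty tw] :=
    @anti_isogram_fold (-1) (- (cos v / cos u)) _ _ x y z w _ _ _ _ _ _ _ _ C.
  - by rewrite sqrrN expr1n.
  - by [].
  - by rewrite mulN1r.
  - by rewrite sD sinD sinB; field.
  - by rewrite sB sinD sinB; field.
  - by rewrite oppr_eq0 mulf_neq0 ?invr_eq0.
  - by [].
  - have -> : -1 * sin (u + v) + sin (u - v) = - (2 * cos u * sin v).
      by rewrite sinD sinB; ring.
    by rewrite oppr_eq0 !mulf_neq0.
  split=> //; first by rewrite ty mulN1r opprK.
  by rewrite (@tan_half_sign _ (-1) x z) ?sqrrN ?expr1n ?mulN1r.
apply/seteqP; split=> [p [x [y [z [w [C ->]]]]]|p [[t _ <-]|[t _ <-]]].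
(* Comparison of the corner entries. *)
- have cz : cos z = cos x.
    have /linkage_closureP E := C.
    have [L00 _ _ _ _] := rot1_mul_rot1 (rot3 (u + v) *m rot1 x *m rot3 (u - v)) y w.
    move: L00; rewrite E trmx_entry.
    have [-> _ _ _ _] := rot3_rot1_rot3 (u + v) x (u - v).
    have [-> _ _ _ _] := rot3_rot1_rot3 (pi - (u + v)) z (pi - (u - v)).
    rewrite !(sinB pi) !(cosB pi) sinpi cospi.
    set a := u + v; set b := u - v => E0.
    have : sin a * sin b * (cos z - cos x) = 0 by lra.
    by move=> /eqP; rewrite !mulf_eq0 (negPf sa) (negPf sb) subr_eq0 => /eqP.
  have : (sin z - sin x) * (sin z + sin x) == 0.
    by rewrite -subr_sqr !sin2cos2 cz subrr.
  rewrite mulf_eq0 subr_eq0 addr_eq0 => /orP[/eqP sz|/eqP sz].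
  + by left; exists (tan_half x) => //; have [-> -> ->] := plus _ _ _ _ cz sz C.
  + by right; exists (tan_half x) => //; have [-> -> ->] := minus _ _ _ _ cz sz C.
(* Closure is solvable for some [y] and [w]; the forward computation then identifies their
   half-angle tangents. *)
- have [y [w C]] := @anti_isogram_closed u v (fold_angle t) _ erefl su cu sv cv.
  exists (fold_angle t), y, (fold_angle t), w; split=> //.
  by have [-> _ ->] := plus _ _ _ _ erefl erefl C; rewrite fold_angleK.
- have [y [w C]] :=
    @anti_isogram_closed u v (fold_angle t) _ (cosN _) su cu sv cv.
  exists (fold_angle t), y, (- fold_angle t), w; split=> //.
  by have [-> -> ->] := minus _ _ _ _ (cosN _) (sinN _) C; rewrite fold_angleK.
Qed.
End AntiIsogram.

(** * Branches as graphs over the circle *)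

Section CircleDilation.
Context {R : realType}.
Implicit Types (k : R) (u : Rhat R) (v : 'rV[R]_2).

(** The squared distances of [v] from [(-1, 0)] and [(1, 0)], the latter weighted by [k ^+ 2]; at
    angle [r] on the circle they are [4 * cos (r / 2) ^+ 2] and [4 * sin (r / 2) ^+ 2]. No point of
    the plane is at distance 0 from both. *)
Definition dilation_den k v :=
  (1 + v 0 0) ^+ 2 + v 0 1 ^+ 2 + k ^+ 2 * ((1 - v 0 0) ^+ 2 + v 0 1 ^+ 2).

(* [(cos r, sin r) |-> (cos r', sin r')] where [tan (r' / 2) = k * tan (r / 2)],
   extended from the circle to a map without poles on the whole plane. *)
Definition circle_dilation k v : 'rV[R]_2 :=
  \row_j [:: ((1 + v 0 0) ^+ 2 + v 0 1 ^+ 2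
               - k ^+ 2 * ((1 - v 0 0) ^+ 2 + v 0 1 ^+ 2)) / dilation_den k v;
             4 * k * v 0 1 / dilation_den k v]`_j.

Lemma dilation_den_neq0 k v : k != 0 -> dilation_den k v != 0.
Proof.
move=> k0; rewrite gt_eqF // /dilation_den.
have k2 : 0 < k ^+ 2 by rewrite lt_def sqrf_eq0 k0 sqr_ge0.
have P := sqr_ge0 (1 + v 0 0); have Q := sqr_ge0 (v 0 1).
have P' := sqr_ge0 (1 - v 0 0).
have [c0|c0] := leP (v 0 0) 0.
  have {}P' : 0 < (1 - v 0 0) ^+ 2 by rewrite exprn_gt0 //; lra.
  by apply: ltr_wpDl; [lra | rewrite mulr_gt0 //; lra].
have {}P : 0 < (1 + v 0 0) ^+ 2 by rewrite exprn_gt0 //; lra.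
by apply: ltr_pwDl; [lra | rewrite mulr_ge0 ?(ltW k2) //; lra].
Qed.

Lemma ord2_case (i : 'I_2) : i = 0 \/ i = 1.
Proof. by case: i => [[|[|]]] //= ?; [left|right]; exact: val_inj. Qed.

Lemma pole_free_circle_dilation k j : k != 0 ->
  pole_free (fun v => circle_dilation k v 0 j).
Proof.
move=> k0.
have p0 : pole_free (fun v => v 0 0) by exact: pole_free_coord.
have p1 : pole_free (fun v => v 0 1 ^+ 2) by apply/pole_freeX/pole_free_coord.
have pc (c : R) : pole_free (fun v : 'rV[R]_2 => c) by exact: pole_free_cst.
have pP : pole_free (fun v => (1 + v 0 0) ^+ 2 + v 0 1 ^+ 2).
  by apply: pole_freeD p1; apply: pole_freeX; exact: pole_freeD.
have pM : pole_free (fun v => k ^+ 2 * ((1 - v 0 0) ^+ 2 + v 0 1 ^+ 2)).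
  by apply: pole_freeM (pc _) _; apply: pole_freeD p1; apply: pole_freeX; exact: pole_freeB.
have pD : pole_free (fun v => (dilation_den k v)^-1).
  by apply: pole_freeV => [|v]; [exact: pole_freeD|exact: dilation_den_neq0].
under eq_fun do rewrite mxE.
have [->|->] /= := ord2_case j; apply: pole_freeM pD; first exact: pole_freeB.
by apply: pole_freeM (pole_free_coord _); exact: pc.
Qed.

Lemma Rhat_embed_scale k u : k != 0 ->
  Rhat_embed (Rhat_scale k u) = circle_dilation k (Rhat_embed u).
Proof.
move=> k0; apply/rowP => j; rewrite !mxE /circle_dilation /dilation_den.
case: u => [t|]; rewrite /Rhat_scale !mxE /=; last first.
  by rewrite cospi sinpi; have [->|->] /= := ord2_case j; field.
rewrite -!/(fold_angle (Some _)) !cos_fold_angle !sin_fold_angle.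
have sq0 (x : R) : 1 + x ^+ 2 != 0 by rewrite gt_eqF // ltr_pwDl // sqr_ge0.
have D0 : (1 + t ^+ 2 + (1 - t ^+ 2)) ^+ 2 + (2 * t) ^+ 2 +
    k ^+ 2 * ((1 + t ^+ 2 - (1 - t ^+ 2)) ^+ 2 + (2 * t) ^+ 2) != 0.
  rewrite (_ : _ + _ = 4 * (1 + t ^+ 2) * (1 + (k * t) ^+ 2)); last by ring.
  by rewrite !mulf_neq0 ?pnatr_eq0.
by have [->|->] /= := ord2_case j; field; rewrite ?sq0 ?D0.
Qed.

Lemma unit_circle_Rhat_embed : @unit_circle R = range (@Rhat_embed R).
Proof.
apply/seteqP; split=> [v /fold_angle_surj[u [cu su]]|_ [u _ <-]].
  exists u => //; apply/rowP => j; rewrite mxE.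
  by have [->|->] := ord2_case j.
by rewrite /unit_circle /= !mxE cos2Dsin2.
Qed.

(** A graph is diffeomorphic to its base: the inverse of the graph map [g] is projection to the
    first circle. *)
Lemma dilation_branch_circle k1 k2 k3 : k1 != 0 -> k2 != 0 -> k3 != 0 ->
  diffeomorphic_to_circle
    [set (t, Rhat_scale k1 t, Rhat_scale k2 t, Rhat_scale k3 t) | t in [set: Rhat R]].
Proof.
move=> h1 h2 h3; set B := (X in diffeomorphic_to_circle X).
pose g v := row_mx (row_mx v (circle_dilation k1 v))
  (row_mx (circle_dilation k2 v) (circle_dilation k3 v)).
have gE t : Rhat4_embed (t, Rhat_scale k1 t, Rhat_scale k2 t, Rhat_scale k3 t)
    = g (Rhat_embed t) by rewrite /Rhat4_embed !Rhat_embed_scale.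
have gK v : lsubmx (lsubmx (g v)) = v by rewrite /g !row_mxKl.
exists (fun p => lsubmx (lsubmx p)), g; split.
- apply: smooth_on_pole_free => j.
  by under eq_fun do rewrite !mxE; exact: pole_free_coord.
- apply: smooth_on_pole_free => j.
  rewrite /g; under eq_fun do rewrite mxE.
  case: splitP => i _; under eq_fun do rewrite mxE; case: splitP => l _.
  + exact: pole_free_coord.
  + exact: pole_free_circle_dilation.
  + exact: pole_free_circle_dilation.
  + exact: pole_free_circle_dilation.
- move=> _ [_ [t _ <-] <-]; rewrite gE gK; split=> //.
  by rewrite unit_circle_Rhat_embed; exists t.
- move=> v; rewrite unit_circle_Rhat_embed => -[t _ <-]; rewrite gK.
  split=> //; exists (t, Rhat_scale k1 t, Rhat_scale k2 t, Rhat_scale k3 t) => //.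
  by exists t.
Qed.

Lemma Rhat_scale1 u : Rhat_scale 1 u = u.
Proof. by case: u => //= t; rewrite mul1r. Qed.

End CircleDilation.

(** * The theorem, in the half-sum and half-difference of the sector angles *)

Theorem mainTheorem8 (R : realType) (alpha beta gamma delta : R)
    (halpha : 0 < alpha < pi) (hbeta : 0 < beta < pi)
    (hgamma : 0 < gamma < pi) (hdelta : 0 < delta < pi)
    (hgammaE : gamma = pi - alpha) (hdeltaE : delta = pi - beta)
    (hneq : beta <> alpha) (hsum : alpha + beta <> pi) :
  config_space alpha beta gamma delta = branch1 alpha beta `|` branch2 alpha beta
  /\ diffeomorphic_to_circle (branch1 alpha beta)
  /\ diffeomorphic_to_circle (branch2 alpha beta).
Proof.
subst gamma delta.
set u := (alpha + beta) / 2; set v := (alpha - beta) / 2.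
have sin0 (x : R) : - pi < x < pi -> x != 0 -> sin x != 0.
  move=> /andP[x1 x2]; rewrite neq_lt => /orP[x0|x0].
    by rewrite -oppr_eq0 -sinN gt_eqF // sin_gt0_pi //; lra.
  by rewrite gt_eqF // sin_gt0_pi //; lra.
have uvE : alpha = u + v by rewrite /u /v; field.
have uvE' : beta = u - v by rewrite /u /v; field.
(* Here [u] lies between 0 and [pi] and [v] strictly within [pi / 2] of 0. The hypothesis [hneq]
   gives [v != 0], and [hsum] gives [u != pi / 2], whence [cos u != 0]. *)
have su : sin u != 0 by apply: sin0; [lra | apply/eqP => ?; lra].
have sv : sin v != 0 by apply: sin0; [lra | apply/eqP => ?; lra].
have cv : cos v != 0 by rewrite gt_eqF // cos_gt0_pihalf //; lra.
have cu : cos u != 0.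
  by rewrite -oppr_eq0 -sinBpihalf; apply: sin0; [lra | apply/eqP => ?; lra].
have sa : sin alpha != 0 by apply: sin0; [lra | apply/eqP => ?; lra].
have sb : sin beta != 0 by apply: sin0; [lra | apply/eqP => ?; lra].
have vE : (beta - alpha) / 2 = - v by rewrite /v; field.
have uE : (beta + alpha) / 2 = u by rewrite /u; field.
have k1 : sin v / sin u != 0 by rewrite mulf_neq0 ?invr_eq0.
have k2 : cos v / cos u != 0 by rewrite mulf_neq0 ?invr_eq0.
have B1 : branch1 alpha beta =
  [set (t, Rhat_scale (- (sin v / sin u)) t, t, Rhat_scale (sin v / sin u) t)
     | t in [set: Rhat R]].
  by rewrite /branch1 vE uE -/u -/v sinN mulNr opprK.
have B2 : branch2 alpha beta =
  [set (t, Rhat_scale (- (cos v / cos u)) t, Rhat_scale (-1) t,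
        Rhat_scale (- (cos v / cos u)) t) | t in [set: Rhat R]].
  by rewrite /branch2 vE uE -/u -/v cosN.
rewrite B1 B2; split.
  by rewrite uvE uvE' config_space_anti_isogram -?uvE -?uvE'.
split; last by apply: dilation_branch_circle; rewrite oppr_eq0 ?oner_eq0.
(* The third coordinate [t] of the first branch is read as the dilation of ratio 1. *)
have := @dilation_branch_circle R (- (sin v / sin u)) 1 (sin v / sin u).
rewrite oppr_eq0 oner_eq0 k1 => /(_ isT isT isT).
by under eq_imagel do rewrite Rhat_scale1.
Qed.
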